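(* Let $T>0$, and let $H$ and $g$ be the Hamiltonian and terminal condition defined in the context. Let $V:[0,T]\times\mathbb{R}\to\mathbb{R}$ be given by $$V(t,x)=\begin{cases}\exp\!\big(-2\sqrt{x-t}\,\big)-1 & \text{if } x\ge t,\\ 1-\exp\!\big(-2\sqrt{t-x}\,\big) & \text{if } 2t-T\le x<t,\\ 1 & \text{if } x<2t-T.\end{cases}$$ Then $V$ is a bounded lower semicontinuous solution of the Hamilton-Jacobi-Bellman equation with Hamiltonian $H$ and terminal condition $g$.
   Context: Define $\varphi:[0,T]\times\mathbb{R}\to\mathbb{R}$ by $\varphi(t,x)=\sqrt{|t-x|}\,\exp\!\big(2\sqrt{|t-x|}\big)$. The Hamiltonian $H:[0,T]\times\mathbb{R}\times\mathbb{R}\to\mathbb{R}$ is $$H(t,x,p)=\begin{cases}0 & \text{if } t\ne x,\ 2|p|\le \frac{1}{\varphi(t,x)},\\[1mm] 2|p|-\frac{1}{\varphi(t,x)} & \text{if } t\neq x,\ 2|p|>\frac{1}{\varphi(t,x)},\\[1mm] 0 & \text{if } t=x,\ p\in\mathbb{R}.\end{cases}$$ The terminal condition $g:\mathbb{R}\to\mathbb{R}$ is $g(x)=\exp(-2\sqrt{x-T})-1$ if $x\ge T$ and $g(x)=1$ if $x<T$. The Hamilton-Jacobi-Bellman (HJB) problem is $-U_t+H(t,x,-U_x)=0$ in $(0,T)\times\mathbb{R}$, $U(T,x)=g(x)$ on $\mathbb{R}$. Subgradients: for $f:\mathbb{R}^m\to\mathbb{R}\cup\{+\infty\}$ and $z$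 with $f(z)<+\infty$, $\partial f(z)$ is the set of $v\in\mathbb{R}^m$ such that $\liminf_{y\to z}\frac{f(y)-f(z)-\langle v,y-z\rangle}{|y-z|}\ge 0$. A function defined on $[0,T]\times\mathbb{R}$ is extended by $+\infty$ outside $[0,T]\times\mathbb{R}$ when its subgradients are considered. Definition: a function $U:[0,T]\times\mathbb{R}\to\mathbb{R}\cup\{+\infty\}$ is a lower semicontinuous solution of HJB if (i) $U$ is lower semicontinuous and $U(T,x)=g(x)$ for all $x\in\mathbb{R}$; (ii) for every $(t,x)$ with $U(t,x)<+\infty$ and every $(p_t,p_x)\in\partial U(t,x)$: $-p_t+H(t,x,-p_x)\ge 0$ if $0\le t<T$, and $-p_t+H(t,x,-p_x)\le 0$ if $0<t\le T$. *)

(* Defs.v *)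
From HB Require Import structures.
From mathcomp Require Import all_boot all_order all_algebra.
From mathcomp Require Import all_classical all_reals all_analysis.
Set Implicit Arguments.
Unset Strict Implicit.
Unset Printing Implicit Defensive.
Import Order.TTheory GRing.Theory Num.Theory.
Import numFieldNormedType.Exports.

Local Open Scope classical_set_scope.
Local Open Scope ring_scope.

Definition dotv (R : realType) (m : nat) (v w : 'rV[R]_m) : R :=
  \sum_(i < m) v 0 i * w 0 i.

(* The library norm on row vectors is the sup norm, hence this definition. *)
Definition enorm (R : realType) (m : nat) (v : 'rV[R]_m) : R :=
  Num.sqrt (dotv v v).

(* The lower limit is over the punctured neighborhoods of z. *)
Definition subgradient (R : realType) (m : nat) (f : 'rV[R]_m -> \bar R)
    (z : 'rV[R]_m) : set 'rV[R]_m :=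
  [set v | (0 <= limf_einf
              (fun y => (f y - f z - (dotv v (y - z))%:E)
                        * ((enorm (y - z))^-1)%:E) z^')%E].

(* Time is coordinate 0 and space is coordinate 1. *)
Definition strip (R : realType) (T : R) : set 'rV[R]_2 :=
  [set z | 0 <= z 0 0 <= T].

Definition pt (R : realType) (t x : R) : 'rV[R]_2 :=
  \row_(i < 2) (if i == 0 then t else x).

(* Functions on [0,T] * R are represented by total functions of (t, x), whose
   values at times outside [0,T] are never used below. *)
Definition on_plane (R : realType) (rT : Type) (U : R -> R -> rT)
    (z : 'rV[R]_2) : rT := U (z 0 0) (z 0 1).

Definition extend (R : realType) (T : R) (U : R -> R -> \bar R)
    (z : 'rV[R]_2) : \bar R :=
  if 0 <= z 0 0 <= T then on_plane U z else +oo%E.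

(* The first clause expresses that U takes its values in R `|` {+oo}; in the
   second one, the topology is the one induced on [0,T] * R (points outside
   are isolated in the type [subspace]). *)
Definition lsc_solution (R : realType) (T : R) (H : R -> R -> R -> R)
    (g : R -> R) (U : R -> R -> \bar R) : Prop :=
  [/\ forall t x : R, 0 <= t <= T -> (-oo < U t x)%E,
      lower_semicontinuous (from_subspace (strip T) (on_plane U)),
      forall x : R, U T x = (g x)%:E
    & forall t x p_t p_x : R, 0 <= t <= T -> (U t x < +oo)%E ->
        subgradient (extend T U) (pt t x) (pt p_t p_x) ->
        (0 <= t < T -> 0 <= - p_t + H t x (- p_x)) /\
        (0 < t <= T -> - p_t + H t x (- p_x) <= 0)].

Definition phi (R : realType) (t x : R) : R :=
  Num.sqrt `|t - x| * expR (2 * Num.sqrt `|t - x|).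

Definition Ham (R : realType) (t x p : R) : R :=
  if t == x then 0
  else if 2 * `|p| <= 1 / phi t x then 0
  else 2 * `|p| - 1 / phi t x.

Definition gT (R : realType) (T x : R) : R :=
  if T <= x then expR (- 2 * Num.sqrt (x - T)) - 1 else 1.

Definition V (R : realType) (T t x : R) : R :=
  if t <= x then expR (- 2 * Num.sqrt (x - t)) - 1
  else if 2 * t - T <= x then 1 - expR (- 2 * Num.sqrt (t - x))
  else 1.

(* Main.v *)
Require Import Defs.
From mathcomp Require Import all_boot all_order all_algebra.
From mathcomp Require Import all_classical all_reals all_analysis.
From mathcomp Require Import ring lra.
Import numFieldNormedType.Exports.
Import Order.TTheory GRing.Theory Num.Theory.
Local Open Scope classical_set_scope.
Local Open Scope ring_scope.
Set Implicit Arguments.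
Unset Strict Implicit.
Unset Printing Implicit Defensive.

(** Up to the terminal time, the value function is a wave travelling at speed
    one, V(t,x) = psi(x - t), on the zone 2t - T <= x, and the constant 1 on the
    other side of the line x = 2t - T.  The profile psi is odd, bounded by 1,
    continuous, of slope -1/phi away from 0 and of slope -oo at 0.

    Since V jumps up to the upper bound of psi when it leaves the closed zone,
    V >= psi(x - t) everywhere with equality on the zone; this gives
    boundedness and lower semicontinuity ([V_ge_profile], [V_lsc]).

    For the differential inequalities, a subgradient p satisfies
    <p, d> <= L for every direction d along which the one-sided difference
    quotients of V have upper limit at most L ([subgradient_le_slope]).
    Directions (a, b) with b >= 2a never leave the zone, and this suffices:
    put q = 1/phi(t,x) and test a subgradient (p_t, p_x) at a point of the zone.
    - (0, 1) gives p_x <= -q < 0, hence H(t,x,-p_x) = -2 p_x - q, so that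
      -p_t + H(t,x,-p_x) = -(p_t + 2 p_x) - q.
    - (1, 2), available for t < T, gives p_t + 2 p_x <= -q, the
      supersolution inequality; (-1, -2), available for t > 0, gives
      p_t + 2 p_x >= -q, the subsolution inequality.
    The same directions handle the interior of the zone, its boundary
    x = 2t - T, and both extreme times, because (1, 2) is tangent to that
    boundary, and because a point at time 0 or T only loses the direction that
    its inequality does not use.  On the diagonal t = x, the vertical slope of
    psi along (0, 1) excludes every subgradient ([V_subgradient_diagonal]).
    Outside of the zone V is locally 1, so p_x = 0 by the directions (0, 1) and
    (0, -1), H(t,x,0) = 0, and (1, 2), (-1, -2) give the sign of p_t. *)

(** * Subgradients and directional slopes *)

Lemma enorm_gt0 (R : realType) (m : nat) (d : 'rV[R]_m) : d != 0 -> 0 < enorm d.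
Proof.
move=> d0; rewrite sqrtr_gt0 lt_neqAle sumr_ge0 ?andbT; last first.
  by move=> i _; exact: sqr_ge0.
apply: contra d0 => /eqP /esym /eqP.
rewrite psumr_eq0 => [/allP h|i _]; last exact: sqr_ge0.
apply/eqP/rowP => i; rewrite mxE; apply/eqP.
by move: (h i (mem_index_enum i)); rewrite mulf_eq0 orbb.
Qed.

Lemma enormZ (R : realType) (m : nat) (s : R) (d : 'rV[R]_m) :
  0 <= s -> enorm (s *: d) = s * enorm d.
Proof.
move=> s0; rewrite /enorm /dotv.
under eq_bigr do rewrite !mxE mulrACA.
by rewrite -mulr_sumr sqrtrM ?sqr_ge0// sqrtr_sqr ger0_norm.
Qed.

Lemma dotvZr (R : realType) (m : nat) (s : R) (v d : 'rV[R]_m) :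
  dotv v (s *: d) = s * dotv v d.
Proof.
by rewrite /dotv mulr_sumr; apply: eq_bigr => i _; rewrite mxE mulrCA.
Qed.

(** The difference quotients in the lower limit defining subgradients range
    over a punctured neighborhood, which a ray enters only if d is nonzero. *)
Lemma ray_dnbhs (R : realType) (m : nat) (z d : 'rV[R]_m) :
  d != 0 -> z + s *: d @[s --> 0^'+] --> z^'.
Proof.
move=> d0 A zA.
have zd : z + s *: d @[s --> 0^'+] --> z.
  rewrite -[X in _ --> X]addr0 -[X in _ + X](scale0r d).
  apply: cvgD; first exact: cvg_cst.
  by apply: cvgZr_tmp; exact: cvg_within.
have h : \forall s \near 0^'+, z + s *: d != z -> A (z + s *: d) := zd _ zA.
suff : \forall s \near 0^'+, A (z + s *: d) by [].
near=> s; have : z + s *: d != z -> A (z + s *: d) by near: s; exact: h.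
apply.
by rewrite -subr_eq0 addrAC subrr add0r scaler_eq0 negb_or d0 andbT gt_eqF.
Unshelve. all: by end_near. Qed.

(** A subgradient bounds the difference quotients of f from below, up to an
    arbitrarily small multiple of the norm; along a ray, an upper bound M of
    the difference quotients must therefore dominate the pairing with d. *)
Lemma subgradient_le_slope (R : realType) (m : nat) (f : 'rV[R]_m -> \bar R)
    (z v d : 'rV[R]_m) (a M : R) : d != 0 -> f z = a%:E ->
  subgradient f z v ->
  (\forall s \near 0^'+, (f (z + s *: d)%R <= (a + M * s)%:E)%E) ->
  dotv v d <= M.
Proof.
move=> d0 fz vf fM; have d_gt0 := enorm_gt0 d0.
apply/ler_addgt0Pr => e e0.
(* The quotients divide by s * enorm d, hence this normalization of e. *)
have : ((- (e / enorm d))%:E < 0)%E by rewrite lte_fin oppr_lt0 divr_gt0.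
move=> /lt_le_trans /(_ vf); rewrite limf_einfE => /ereal_sup_gt[_ [A zA <-]] eA.
have [s [s0 sA sM]] : exists s, [/\ 0 < s, A (z + s *: d) &
    (f (z + s *: d)%R <= (a + M * s)%:E)%E].
  near (0 : R)^'+ => s; exists s; split => //.
    near: s; exact: (ray_dnbhs d0 zA).
  near: s; exact: fM.
have := lt_le_trans eA (ereal_inf_lbound (ex_intro2 _ _ _ sA erefl)).
have zd : z + s *: d - z = s *: d by rewrite addrAC subrr add0r.
rewrite zd fz dotvZr (enormZ _ (ltW s0)) => h.
have {}h := lt_le_trans h (lee_wpmul2r _ (leeB (leeB sM (lexx a%:E)) (lexx _))).
have : ((- (e / enorm d))%:E
    < ((a + M * s - a - s * dotv v d) / (s * enorm d))%:E)%E.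
  by rewrite EFinM !EFinB; apply: h; rewrite lee_fin invr_ge0 mulr_ge0// ltW.
rewrite lte_fin ltr_pdivlMr ?mulr_gt0//.
have -> : - (e / enorm d) * (s * enorm d) = s * - e.
  by field; rewrite gt_eqF.
have -> : a + M * s - a - s * dotv v d = s * (M - dotv v d) by ring.
by rewrite ltr_pM2l//; lra.
Unshelve. all: by end_near.
Qed.

(** * The travelling profile *)

(** As the square root of a negative number is 0, one of the two exponentials is
    always 1: this is the odd extension of u |-> exp(-2 sqrt u) - 1, written
    without case analysis so that its continuity at 0 is immediate. *)
Definition profile (R : realType) (u : R) : R :=
  expR (- 2 * Num.sqrt u) - expR (- 2 * Num.sqrt (- u)).

Lemma profile_ge0E (R : realType) (u : R) :
  0 <= u -> profile u = expR (- 2 * Num.sqrt u) - 1.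
Proof.
by move=> u0; rewrite /profile (ler0_sqrtr (_ : - u <= 0)) ?oppr_le0// mulr0 expR0.
Qed.

Lemma profileN (R : realType) (u : R) : profile (- u) = - profile u.
Proof. by rewrite /profile opprK opprB. Qed.

Lemma profile0 (R : realType) : profile (0 : R) = 0.
Proof. by rewrite /profile oppr0 subrr. Qed.

Lemma profile_le0E (R : realType) (u : R) :
  u <= 0 -> profile u = 1 - expR (- 2 * Num.sqrt (- u)).
Proof.
by move=> u0; rewrite -[u]opprK profileN profile_ge0E ?oppr_ge0// opprK opprB.
Qed.

Lemma profile_le1 (R : realType) (u : R) : `|profile u| <= 1.
Proof.
have b (v : R) : 0 <= expR (- 2 * Num.sqrt v) <= 1.
  by rewrite expR_ge0 -expR0 ler_expR mulNr oppr_le0 mulr_ge0// sqrtr_ge0.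
rewrite /profile ler_norml; move: (b u) (b (- u)); lra.
Qed.

Lemma continuous_profile (R : realType) : continuous (@profile R).
Proof.
have c : continuous (fun u : R => expR (- 2 * Num.sqrt u)).
  move=> u; apply: continuous_comp; last exact: continuous_expR.
  by apply: cvgM; [exact: cvg_cst|exact: sqrt_continuous].
move=> u; apply: (@continuousB _ _ _ _ _ u); first exact: c.
have o : (- x : R) @[x --> u] --> - u by exact: opp_continuous.
exact: (cvg_comp _ _ o (c (- u))).
Qed.

(** The slope is -1/phi: for u = x - t the denominator is phi t x. *)
Lemma is_derive_profile (R : realType) (u : R) : u != 0 ->
  is_derive u 1 (@profile R)
    (- (Num.sqrt `|u| * expR (2 * Num.sqrt `|u|))^-1).
Proof.
have pos (v : R) : 0 < v -> is_derive v 1 (@profile R)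
    (- (Num.sqrt v * expR (2 * Num.sqrt v))^-1).
  move=> v0; have sv := is_derive1_sqrt v0.
  have : is_derive v 1 (fun w => expR (- 2 * Num.sqrt w) - 1)
      (- (Num.sqrt v * expR (2 * Num.sqrt v))^-1).
    have h : is_derive v 1 (-2 \*: @Num.sqrt R) (-2 *: (2 * Num.sqrt v)^-1).
      exact: is_deriveZ.
    have h2 := is_deriveB (is_derive1_comp (is_derive_expR _) h)
      (is_derive_cst (1 : R) v 1).
    apply: (is_derive_eq h2).
    have r0 : 0 < Num.sqrt v by rewrite sqrtr_gt0.
    have -> : expR ((-2 \*: @Num.sqrt R) v) = (expR (2 * Num.sqrt v))^-1.
      by rewrite -expRN -mulNr.
    rewrite /GRing.scale /=.
    by field; rewrite !gt_eqF ?expR_gt0.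
  apply: near_eq_is_derive.
  near=> w; rewrite profile_ge0E//; apply: ltW; near: w; exact: lt_nbhsr.
move=> u0; have [up|un] := ltP 0 u.
  by rewrite gtr0_norm//; exact: pos.
have {u0}un : 0 < - u by rewrite oppr_gt0 lt_neqAle u0.
have h : is_derive u 1 (-%R : R -> R) (- 1) by exact: is_deriveNid.
have := is_deriveN (is_derive1_comp (pos _ un) h).
rewrite -normrN gtr0_norm// mulrN1 opprK.
have -> // : - (@profile R \o -%R) = @profile R.
by apply/funext => w; rewrite fctE/= profileN opprK.
Unshelve. all: by end_near. Qed.

(** Near 0 the profile behaves like -2 sqrt s, which is below every line
    through the origin. *)
Lemma profile_cusp (R : realType) (K : R) :
  \forall s \near 0^'+, profile s <= K * s.
Proof.
near=> s.
have s0 : 0 < s by [].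
have ss := sqr_sqrtr (ltW s0).
have r0 : 0 < Num.sqrt s by rewrite sqrtr_gt0.
have e0 := expR_gt0 (2 * Num.sqrt s).
have e1 := expR_ge1Dx (2 * Num.sqrt s).
have r1 : Num.sqrt s <= 1 / (2 + `|K|).
  have q0 : 0 < 1 / (2 + `|K|) by rewrite divr_gt0// ltr_wpDr.
  rewrite -(ler_pXn2r (n := 2)) ?nnegrE ?(ltW r0) ?(ltW q0)// ss.
  by near: s; apply: nbhs_right_le; rewrite exprn_gt0.
have -> : K * s = K * Num.sqrt s ^+ 2 by rewrite ss.
rewrite (profile_ge0E (ltW s0)) mulNr expRN.
have k0 : 0 < 2 + `|K| by rewrite ltr_wpDr.
move: r1; rewrite ler_pdivlMr// => r1.
rewrite lerBlDr -div1r ler_pdivrMr//.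
have [? ?] : - `|K| <= K /\ 0 <= `|K| by rewrite lerNnormlW// normr_ge0.
(* With r = sqrt s the claim is 1 <= (1 + K r^2) exp(2r); the threshold on s
   makes 1 + K r^2 >= 1 - r + 2 r^2, whose product with 1 + 2r is 1 + r + 4 r^3. *)
set r := Num.sqrt s in r0 e1 r1 e0 *.
have Kr : - (K * r ^+ 2) <= r - 2 * r ^+ 2 by nra.
have : (1 - r + 2 * r ^+ 2) * (1 + 2 * r) <= (K * r ^+ 2 + 1) * expR (2 * r).
  by apply: ler_pM => //; nra.
apply: le_trans; have : 0 <= r ^+ 3 by rewrite exprn_ge0// ltW.
nra.
Unshelve. all: by end_near. Qed.

Lemma is_derive_right_slope (R : realType) (f : R -> R) (u D c e : R) :
  is_derive u 1 f D -> 0 < e ->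
  \forall s \near 0^'+, f (u + c * s) - f u <= (c * D + e) * s.
Proof.
move=> /is_derive1_caratheodory[g [fg gc gu]] e0.
have cg : c * g (u + c * s) @[s --> 0^'+] --> c * D.
  apply: cvgM; first exact: cvg_cst.
  have h : u + c * s @[s --> 0^'+] --> u.
    rewrite -[X in _ --> X]addr0 -[X in _ + X](mulr0 c).
    apply: cvgD; first exact: cvg_cst.
    by apply: cvgM; [exact: cvg_cst|exact: cvg_within].
  by rewrite -gu; exact: (cvg_comp _ _ h gc).
near=> s; rewrite fg addrAC subrr add0r mulrA ler_pM2r//.
rewrite [_ * c]mulrC; near: s; apply: (cvgr_le _ cg); rewrite ltrDl//.
Unshelve. all: by end_near. Qed.

(** * The value function *)

Lemma dotv_pt (R : realType) (a b c d : R) :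
  dotv (pt a b) (pt c d) = a * c + b * d.
Proof. by rewrite /dotv big_ord_recl big_ord1 !mxE. Qed.

Lemma pt_ray (R : realType) (t x a b s : R) :
  pt t x + s *: pt a b = pt (t + s * a) (x + s * b).
Proof. by apply/rowP => i; rewrite !mxE; case: ifP. Qed.

Lemma pt_neq0 (R : realType) (a b : R) : b != 0 -> pt a b != 0.
Proof.
by apply: contra => /eqP/rowP/(_ 1); rewrite !mxE/= => ->.
Qed.

Lemma V_lower (R : realType) (T t x : R) :
  t <= T -> 2 * t - T <= x -> V T t x = profile (x - t).
Proof.
move=> tT xt; rewrite /V; case: ifPn => [tx|]; first by rewrite profile_ge0E ?subr_ge0.
by rewrite -ltNge => tx; rewrite xt profile_le0E ?subr_le0 ?ltW// opprB.
Qed.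

Lemma V_upper (R : realType) (T t x : R) :
  t <= T -> x < 2 * t - T -> V T t x = 1.
Proof.
move=> tT xt; rewrite /V ifF ?ifF//; apply/negbTE; rewrite -ltNge//; lra.
Qed.

(** The profile never exceeds the value 1 taken outside of the zone, so the
    discontinuity of V along x = 2t - T is an upward jump out of a closed set. *)
Lemma V_ge_profile (R : realType) (T t x : R) : t <= T -> profile (x - t) <= V T t x.
Proof.
move=> tT; have [xt|xt] := leP (2 * t - T) x; first by rewrite V_lower.
by rewrite V_upper// (le_trans (ler_norm _))// profile_le1.
Qed.

Lemma V_bounded (R : realType) (T t x : R) : t <= T -> `|V T t x| <= 1.
Proof.
move=> tT; have [xt|xt] := leP (2 * t - T) x.
  by rewrite V_lower// profile_le1.
by rewrite V_upper// normr1.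
Qed.

(** In the zone V is minorized everywhere by a continuous function that agrees
    with it at z; outside of the zone, which is an open condition, V is maximal. *)
Lemma V_gt_near (R : realType) (T a : R) (z : 'rV[R]_2) :
  strip T z -> a < on_plane (V T) z ->
  \forall y \near z, strip T y -> a < on_plane (V T) y.
Proof.
rewrite /on_plane => /andP[_ tT] az.
have co i : (fun y : 'rV[R]_2 => y 0 i) @ z --> z 0 i by exact: coord_continuous.
have [xt|xt] := leP (2 * z 0 0 - T) (z 0 1).
  rewrite V_lower// in az.
  have c : (fun y : 'rV[R]_2 => profile (y 0 1 - y 0 0)) @ z
      --> profile (z 0 1 - z 0 0).
    apply: cvg_comp; last exact: continuous_profile.
    exact: cvgB (co 1) (co 0).
  apply: filterS (cvgr_gt _ c _ az) => y ay /andP[_ yT].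
  exact: lt_le_trans ay (V_ge_profile _ yT).
rewrite V_upper// in az.
have c : (fun y : 'rV[R]_2 => y 0 1 - 2 * y 0 0) @ z --> z 0 1 - 2 * z 0 0.
  by apply: cvgB (co 1) _; apply: cvgM (co 0); exact: cvg_cst.
have zT : z 0 1 - 2 * z 0 0 < - T by lra.
apply: filterS (cvgr_lt _ c _ zT) => y ay /andP[_ yT].
by rewrite V_upper//; lra.
Qed.

Lemma V_lsc (R : realType) (T : R) : lower_semicontinuous
  (from_subspace (strip T) (on_plane (fun t x => (V T t x)%:E))).
Proof.
move=> z a az; exists [set y | (a%:E < on_plane (fun t x => (V T t x)%:E) y)%E] => //.
case: (nbhs_subspaceP (strip T) z) => [zT|_ y ->//].
exact: (V_gt_near (z := z) zT).
Qed.

(** * Testing subgradients along directions *)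

(** At the extreme times 0 and T, only the rays staying in the strip give
    information, as the extended function is infinite outside. *)
Definition feasible (R : realType) (T t a : R) : Prop :=
  \forall s \near 0^'+, 0 <= t + s * a <= T.

Definition V_subgradient (R : realType) (T t x p_t p_x : R) : Prop :=
  subgradient (extend T (fun t x => (V T t x)%:E)) (pt t x) (pt p_t p_x).

Lemma forward_feasible (R : realType) (T t : R) :
  0 <= t -> t < T -> feasible T t 1.
Proof.
move=> t0 tT; near=> s; have s0 : 0 < s by [].
have : s <= T - t by near: s; apply: nbhs_right_le; rewrite subr_gt0.
by move=> h; apply/andP; split; lra.
Unshelve. all: by end_near. Qed.

Lemma backward_feasible (R : realType) (T t : R) :
  0 < t -> t <= T -> feasible T t (- 1).
Proof.
move=> t0 tT; near=> s; have s0 : 0 < s by [].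
have : s <= t by near: s; exact: nbhs_right_le.
by move=> h; apply/andP; split; lra.
Unshelve. all: by end_near. Qed.

Lemma still_feasible (R : realType) (T t : R) :
  0 <= t <= T -> feasible T t 0.
Proof. by move=> tT; near=> s; rewrite mulr0 addr0. Unshelve. all: by end_near. Qed.

Lemma extend_pt (R : realType) (T s y : R) (U : R -> R -> \bar R) :
  0 <= s <= T -> extend T U (pt s y) = U s y.
Proof. by rewrite /extend /on_plane !mxE/= => ->. Qed.

(** The slack e turns an upper bound L of the limit of the difference quotients,
    which is what a derivative provides, into a bound of the quotients. *)
Lemma V_subgradient_le_slope (R : realType) (T t x p_t p_x a b L : R) :
  0 <= t <= T -> V_subgradient T t x p_t p_x -> b != 0 ->
  feasible T t a ->
  (forall e, 0 < e -> \forall s \near 0^'+, 0 <= t + s * a <= T ->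
    V T (t + s * a) (x + s * b) - V T t x <= (L + e) * s) ->
  p_t * a + p_x * b <= L.
Proof.
move=> tT pV b0 feas slope; rewrite -dotv_pt; apply/ler_addgt0Pr => e /slope {}slope.
apply: (subgradient_le_slope (pt_neq0 a b0) (extend_pt x _ tT) pV).
near=> s.
have fs : 0 <= t + s * a <= T by near: s.
rewrite pt_ray extend_pt// lee_fin -lerBlDl.
by near: s; apply: filterS2 feas slope => s fs; apply.
Unshelve. all: by end_near. Qed.

(** In the zone, V changes along (a, b) as the profile along b - a. *)
Lemma V_subgradient_lower (R : realType) (T t x p_t p_x a b : R) :
  0 <= t <= T -> V_subgradient T t x p_t p_x ->
  2 * t - T <= x -> t != x -> 2 * a <= b -> b != 0 ->
  feasible T t a ->
  p_t * a + p_x * b <= - (b - a) / phi t x.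
Proof.
move=> tT pV xt tx ab b0 feas; apply: (V_subgradient_le_slope tT pV) =>// e e0.
have [t0 tleT] := andP tT.
have xt0 : x - t != 0 by rewrite subr_eq0 eq_sym.
have := is_derive_right_slope (b - a) (is_derive_profile xt0) e0.
apply: filter_app; near=> s => + /andP[_ sT].
have s0 : 0 < s by [].
rewrite !V_lower//; last by nra.
rewrite -distrC -/(phi t x) mulrN mulNr.
by have -> : x + s * b - (t + s * a) = x - t + (b - a) * s by ring.
Unshelve. all: by end_near. Qed.

(** Testing against (0, 1), along which the slope of V is -oo, with the bound
    p_x - 1 is absurd. *)
Lemma V_subgradient_diagonal (R : realType) (T t x p_t p_x : R) :
  0 <= t <= T -> V_subgradient T t x p_t p_x -> t != x.
Proof.
move=> tT pV; apply/eqP => tx; have [t0 tleT] := andP tT.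
suff : p_t * 0 + p_x * 1 <= p_x - 1 by lra.
apply: (V_subgradient_le_slope tT pV); [exact: oner_neq0|exact: still_feasible|].
move=> e e0; near=> s => _; have s0 : 0 < s by [].
rewrite mulr0 addr0 mulr1 !V_lower -?tx; try lra.
have -> : t + s - t = s by ring.
rewrite [t - t]subrr profile0 subr0; near: s; exact: profile_cusp.
Unshelve. all: by end_near. Qed.

(** Outside of the zone V is locally constant.  The line x = 2t - T is never
    crossed when b <= 2a, and not before a positive time when a = 0. *)
Lemma V_subgradient_upper (R : realType) (T t x p_t p_x a b : R) :
  0 <= t <= T -> V_subgradient T t x p_t p_x ->
  x < 2 * t - T -> b != 0 ->
  (b <= 2 * a \/ a = 0) ->
  feasible T t a ->
  p_t * a + p_x * b <= 0.
Proof.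
move=> tT pV xt b0 ab feas; apply: (V_subgradient_le_slope tT pV) => // e e0.
have [t0 tleT] := andP tT.
near=> s => /andP[_ sT]; have s0 : 0 < s by [].
rewrite !V_upper//; first by rewrite subrr add0r mulr_ge0// ltW.
case: ab => [ab|->]; first by nra.
have : s * `|b| < 2 * t - T - x.
  rewrite -ltr_pdivlMr ?normr_gt0//; near: s; apply: nbhs_right_lt.
  by rewrite divr_gt0 ?normr_gt0// subr_gt0.
have : s * b <= s * `|b| by rewrite ler_pM2l// ler_norm.
lra.
Unshelve. all: by end_near. Qed.

Lemma phi_gt0 (R : realType) (t x : R) : t != x -> 0 < phi t x.
Proof.
by move=> tx; rewrite mulr_gt0 ?expR_gt0// sqrtr_gt0 normr_gt0 subr_eq0.
Qed.

(** The Hamiltonian is evaluated from (0, 1) and (0, -1); the two inequalities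
    then come from the two orientations of the direction (1, 2). *)
Lemma V_HJB (R : realType) (T t x p_t p_x : R) :
  0 <= t <= T -> V_subgradient T t x p_t p_x ->
  (0 <= t < T -> 0 <= - p_t + Ham t x (- p_x)) /\
  (0 < t <= T -> - p_t + Ham t x (- p_x) <= 0).
Proof.
move=> tT pV; have tx := V_subgradient_diagonal tT pV; have f0 := phi_gt0 tx.
have q0 : 0 < (phi t x)^-1 by rewrite invr_gt0.
have [zone|zone] := leP (2 * t - T) x.
  have h a b := @V_subgradient_lower R T t x p_t p_x a b tT pV zone tx.
  have hx : p_x <= - (phi t x)^-1.
    have : p_t * 0 + p_x * 1 <= - (1 - 0) / phi t x.
      by apply: h (still_feasible tT); rewrite ?oner_neq0//; lra.
    by move: (phi t x)^-1 => q; lra.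
  have -> : Ham t x (- p_x) = - 2 * p_x - (phi t x)^-1.
    rewrite /Ham (negbTE tx) div1r normrN ler0_norm; last lra.
    by rewrite ifF; [lra|apply/negbTE; rewrite -ltNge; lra].
  split => /andP[t0 tT'].
    have : p_t * 1 + p_x * 2 <= - (2 - 1) / phi t x.
      by apply: h (forward_feasible t0 tT'); rewrite ?pnatr_eq0//; lra.
    by move: (phi t x)^-1 => q; lra.
  have : p_t * (- 1) + p_x * (- 2) <= - (- 2 - - 1) / phi t x.
    by apply: h (backward_feasible t0 tT'); rewrite ?oppr_eq0 ?pnatr_eq0//; lra.
  by move: (phi t x)^-1 => q; lra.
have h a b := @V_subgradient_upper R T t x p_t p_x a b tT pV zone.
have px0 : p_x = 0.
  have h1 := h 0 1 (oner_neq0 _) (or_intror erefl) (still_feasible tT).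
  have n1 : - 1 != 0 :> R by rewrite oppr_eq0 oner_eq0.
  have h2 := h 0 (- 1) n1 (or_intror erefl) (still_feasible tT).
  lra.
have -> : Ham t x (- p_x) = 0.
  by rewrite /Ham px0 oppr0 normr0 mulr0 div1r (ltW q0); case: ifP.
split => /andP[t0 tT'].
  have : p_t * 1 + p_x * 2 <= 0.
    by apply: h (forward_feasible t0 tT'); rewrite ?pnatr_eq0//; left; lra.
  rewrite px0; lra.
have : p_t * (- 1) + p_x * (- 2) <= 0.
  apply: h (backward_feasible t0 tT'); rewrite ?oppr_eq0 ?pnatr_eq0//; left; lra.
rewrite px0; lra.
Qed.

Theorem theorem4p3 (R : realType) (T : R) (T_gt0 : 0 < T) :
  [bounded on_plane (V T) z | z in strip T] /\
  lsc_solution T (@Ham R) (gT T) (fun t x => (V T t x)%:E).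
Proof.
split.
  rewrite /bounded_near; near=> M => z /andP[_ tT] /=.
  apply: (le_trans (V_bounded (z 0 1) tT)).
  by near: M; exact: nbhs_pinfty_ge.
split.
- by move=> t x _; exact: ltNyr.
- exact: V_lsc.
- move=> x; rewrite /V /gT; case: ifPn => // xT.
  by rewrite ifF//; apply/negbTE; move: xT; rewrite -!ltNge; lra.
- by move=> t x p_t p_x tT _ pV; exact: V_HJB tT pV.
Unshelve. all: by end_near. Qed.
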